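(* Let $\{\mathcal{A},G,\sigma,\alpha\}$ be a $G$-crossed system with $G\neq\{e\}$ and $\mathcal{A}$ commutative. Then $\tilde{\mathcal{A}}$ is maximal commutative in $\mathcal{A}\rtimes_\alpha^\sigma G$ if and only if, for each pair $(s,r_s)\in(G\setminus\{e\})\times(\mathcal{A}\setminus\{0_{\mathcal{A}}\})$, there exists $a\in\mathcal{A}$ such that $\sigma_s(a)-a\notin\mathrm{Ann}(r_s)=\{c\in\mathcal{A}\mid r_s\cdot c=0_{\mathcal{A}}\}$.
   Context: A $G$-crossed system is a quadruple $\{\mathcal{A},G,\sigma,\alpha\}$ consisting of a unital associative ring $\mathcal{A}$, a group $G$ with unit $e$, a map $\sigma:G\to\mathrm{Aut}(\mathcal{A})$, $x\mapsto\sigma_x$, into the ring automorphisms of $\mathcal{A}$, and a map $\alpha:G\times G\to U(\mathcal{A})$ into the group of invertible elements of $\mathcal{A}$, such that for all $x,y,z\in G$, $a\in\mathcal{A}$: (i) $\sigma_x(\sigma_y(a))=\alpha(x,y)\,\sigma_{xy}(a)\,\alpha(x,y)^{-1}$; (ii) $\alpha(x,y)\,\alpha(xy,z)=\sigma_x(\alpha(y,z))\,\alpha(x,yz)$; (iii) $\alpha(x,e)=\alpha(e,x)=1_{\mathcal{A}}$. The crossed product $\mathcal{A}\rtimes_\alpha^\sigma G$ is the free left $\mathcal{A}$-module with basis $\{\overline{g}: g\in G\}$ (a copy of $G$), made into an associative unital ring by the biadditive multiplication determined by $(a_1\overline{x})(a_2\overline{y})=a_1\sigma_x(a_2)\,\alpha(x,y)\,\overline{xy}$.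 Its elements are formal sums $\sum_{g\in G}a_g\overline{g}$ with $a_g\in\mathcal{A}$, all but finitely many zero. $\tilde{\mathcal{A}}=\{a\overline{e}\mid a\in\mathcal{A}\}$ is the embedded copy of $\mathcal{A}$, and $\mathrm{Comm}(\tilde{\mathcal{A}})=\{b\in\mathcal{A}\rtimes_\alpha^\sigma G\mid ab=ba\ \forall a\in\tilde{\mathcal{A}}\}$. ''$\tilde{\mathcal{A}}$ is maximal commutative in $\mathcal{A}\rtimes_\alpha^\sigma G$'' means $\mathrm{Comm}(\tilde{\mathcal{A}})=\tilde{\mathcal{A}}$. *)

(* Defs.v *)
From HB Require Import structures.
From mathcomp Require Import all_boot all_algebra finmap.
From mathcomp Require Import monalg.
From mathcomp Require Import boolp classical_sets.

Set Implicit Arguments.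
Unset Strict Implicit.
Unset Printing Implicit Defensive.

Import GRing.Theory.

Local Open Scope ring_scope.

Record ring_aut (A : pzRingType) := RingAut {
  aut_fun :> {rmorphism A -> A};
  aut_bij : bijective aut_fun
}.

(* U(A) for an arbitrary ring, where invertibility need not be decidable. *)
Record invertible (A : pzRingType) := Invertible {
  uval : A;
  uinv : A;
  uvalK : uval * uinv = 1;
  uinvK : uinv * uval = 1
}.

Record crossed_system (G : groupType) (A : pzRingType) := CrossedSystem {
  sigma : G -> ring_aut A;
  alpha : G -> G -> invertible A;
  sigma_sigma : forall x y a,
    sigma x (sigma y a)
    = uval (alpha x y) * sigma (x * y)%g a * uinv (alpha x y);
  alpha_cocycle : forall x y z,
    uval (alpha x y) * uval (alpha (x * y)%g z)
    = sigma x (uval (alpha y z)) * uval (alpha x (y * z)%g);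
  alpha_1r : forall x, uval (alpha x 1%g) = 1;
  alpha_1l : forall x, uval (alpha 1%g x) = 1
}.

(* Finitely supported functions G -> A; f@_g is the coefficient of g. *)
Definition crossed_product (G : groupType) (A : pzRingType)
  (S : crossed_system G A) : Type := {malg A[G]}.

HB.instance Definition _ (G : groupType) (A : pzRingType)
  (S : crossed_system G A) := GRing.Zmodule.on (crossed_product S).

Section CrossedProduct.
Context (G : groupType) (A : pzRingType) (S : crossed_system G A).

Local Notation R := (crossed_product S).
Local Notation sg := (sigma S).
Local Notation al x y := (uval (alpha S x y)).
Implicit Types (f g h : R) (x y z : G) (a b c : A).

(* a \overline{x} *)
Definition monom a x : R := << a *g x >>.

Definition cp_scale a f : R := \sum_(x <- msupp f) monom (a * f@_x) x.

Definition cp_mul f g : R :=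
  \sum_(x <- msupp f) \sum_(y <- msupp g)
    monom (f@_x * sg x g@_y * al x y) (x * y)%g.

Definition cp_one : R := monom 1 1%g.

Lemma monomD x : {morph monom^~ x : a b / a + b}.
Proof. by move=> a b; apply: (monalgUD x). Qed.

Lemma monom0 x : monom 0 x = 0.
Proof. exact: (monalgU0 x). Qed.

Lemma coeff_monom a x y : (monom a x)@_y = a *+ (x == y).
Proof. exact: mcoeffU. Qed.

Lemma cp_scaleE a f x : (cp_scale a f)@_x = a * f@_x.
Proof.
rewrite {2}(monalgE f) /cp_scale !raddf_sum mulr_sumr.
by apply/eq_bigr=> y _ /=; rewrite coeff_monom mcoeffU mulrnAr.
Qed.

Fact cp_scaleA a b f : cp_scale a (cp_scale b f) = cp_scale (a * b) f.
Proof. by apply/malgP=> x; rewrite !cp_scaleE mulrA. Qed.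

Fact cp_scale1 : left_id 1 cp_scale.
Proof. by move=> f; apply/malgP=> x; rewrite cp_scaleE mul1r. Qed.

Fact cp_scaleDr : right_distributive cp_scale +%R.
Proof.
by move=> a f g; apply/malgP=> x; rewrite !(cp_scaleE, mcoeffD) mulrDr.
Qed.

Fact cp_scaleDl f : {morph cp_scale^~ f : a b / a + b}.
Proof.
by move=> a b; apply/malgP=> x; rewrite !(cp_scaleE, mcoeffD) mulrDl.
Qed.

HB.instance Definition _ := GRing.Zmodule_isLmodule.Build A (crossed_product S)
  cp_scaleA cp_scale1 cp_scaleDr cp_scaleDl.

Lemma monomE a x : monom a x = a *: monom 1 x.
Proof.
by apply/malgP=> y; rewrite cp_scaleE !coeff_monom mulrnAr mulr1.
Qed.

Lemma cp_expand f : f = \sum_(x <- msupp f) f@_x *: monom 1 x.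
Proof.
rewrite {1}(monalgE f); apply: eq_bigr => x _; exact: (monomE f@_x x).
Qed.

Lemma cp_mulw (d1 d2 : {fset G}) f g :
    (msupp f `<=` d1)%fset -> (msupp g `<=` d2)%fset ->
  cp_mul f g = \sum_(x <- d1) \sum_(y <- d2)
    monom (f@_x * sg x g@_y * al x y) (x * y)%g.
Proof.
move=> le1 le2; rewrite /cp_mul (big_fset_incl _ le1) /=.
  apply/eq_bigr=> x _; apply/big_fset_incl => // y _ /mcoeff_outdom ->.
  by rewrite rmorph0 mulr0 mul0r monom0.
move=> x _ /mcoeff_outdom ->.
by rewrite big1 => // y _; rewrite !mul0r monom0.
Qed.

Fact cp_mulDl : left_distributive cp_mul +%R.
Proof.
move=> f g h; have sfg := msuppD_le f g.
rewrite (cp_mulw sfg (fsubset_refl _)).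
rewrite (cp_mulw (fsubsetUl (msupp f) (msupp g)) (fsubset_refl (msupp h))).
rewrite (cp_mulw (fsubsetUr (msupp f) (msupp g)) (fsubset_refl (msupp h))).
rewrite -big_split; apply: eq_bigr => x _ /=.
rewrite -big_split; apply: eq_bigr => y _ /=.
by rewrite mcoeffD !mulrDl monomD.
Qed.

Fact cp_mulDr : right_distributive cp_mul +%R.
Proof.
move=> f g h; have sgh := msuppD_le g h.
rewrite (cp_mulw (fsubset_refl _) sgh).
rewrite (cp_mulw (fsubset_refl (msupp f)) (fsubsetUl (msupp g) (msupp h))).
rewrite (cp_mulw (fsubset_refl (msupp f)) (fsubsetUr (msupp g) (msupp h))).
rewrite -big_split; apply: eq_bigr => x _ /=.
rewrite -big_split; apply: eq_bigr => y _ /=.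
by rewrite mcoeffD rmorphD mulrDr mulrDl monomD.
Qed.

Lemma cp_mul_monom a x b y :
  cp_mul (monom a x) (monom b y) = monom (a * sg x b * al x y) (x * y)%g.
Proof.
rewrite (cp_mulw (msuppU_le (k := x) (x := a)) (msuppU_le (k := y) (x := b))).
by rewrite !big_seq_fset1 !coeff_monom !eqxx.
Qed.

Fact cp_mul0l : left_zero 0 cp_mul.
Proof. by move=> f; rewrite /cp_mul msupp0 big_seq_fset0. Qed.

Fact cp_mul0r : right_zero 0 cp_mul.
Proof.
by move=> f; rewrite /cp_mul big1 // => x _; rewrite msupp0 big_seq_fset0.
Qed.

Lemma cp_ind (P : R -> Prop) :
    P 0 -> (forall f g, P f -> P g -> P (f + g)) ->
    (forall a x, P (monom a x)) ->
  forall f, P f.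
Proof.
move=> P0 PD PM f; rewrite (monalgE f); elim/big_ind: _ => // x _.
exact: PM.
Qed.

Fact cp_mulA : associative cp_mul.
Proof.
move=> f g h.
elim/cp_ind: f => [|f1 f2 IH1 IH2|a x]; first by rewrite !cp_mul0l.
  by rewrite !cp_mulDl IH1 IH2.
elim/cp_ind: g => [|g1 g2 IH1 IH2|b y]; first by rewrite !(cp_mul0l, cp_mul0r).
  by rewrite !(cp_mulDl, cp_mulDr) IH1 IH2.
elim/cp_ind: h => [|h1 h2 IH1 IH2|c z]; first by rewrite !cp_mul0r.
  by rewrite !cp_mulDr IH1 IH2.
rewrite !cp_mul_monom mulgA; congr monom.
rewrite !rmorphM sigma_sigma -!mulrA; do 3 congr (_ * _).
by rewrite -alpha_cocycle !mulrA -(mulrA _ (uinv _)) uinvK mulr1.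
Qed.

Lemma sigma1 a : sg 1%g a = a.
Proof.
have [i sK _] := aut_bij (sg 1%g); apply: (can_inj sK).
rewrite sigma_sigma mulg1.
have a1 := alpha_1l S 1%g.
have i1 : uinv (alpha S 1%g 1%g) = 1 by rewrite -[LHS]mul1r -{1}a1 uvalK.
by rewrite a1 i1 mul1r mulr1.
Qed.

Fact cp_mul1l : left_id cp_one cp_mul.
Proof.
elim/cp_ind=> [|f g IH1 IH2|a x]; first exact: cp_mul0r.
  by rewrite cp_mulDr IH1 IH2.
by rewrite cp_mul_monom sigma1 alpha_1l mul1g mul1r mulr1.
Qed.

Fact cp_mul1r : right_id cp_one cp_mul.
Proof.
elim/cp_ind=> [|f g IH1 IH2|a x]; first exact: cp_mul0l.
  by rewrite cp_mulDl IH1 IH2.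
by rewrite cp_mul_monom rmorph1 alpha_1r mulg1 !mulr1.
Qed.

HB.instance Definition _ := GRing.Zmodule_isPzRing.Build (crossed_product S)
  cp_mulA cp_mul1l cp_mul1r cp_mulDl cp_mulDr.

Lemma monomM a x b y :
  monom a x * monom b y = monom (a * sg x b * al x y) (x * y)%g.
Proof. exact: cp_mul_monom. Qed.

Definition embedded : set (crossed_product S) :=
  [set f | exists a : A, f = monom a 1%g].

End CrossedProduct.

Arguments monom {G A} S a x.
Arguments embedded {G A} S _.

Definition Comm (R : pzRingType) (B : set R) : set R :=
  [set b | forall a, B a -> a * b = b * a].

Definition maximal_commutative (R : pzRingType) (B : set R) : Prop :=
  Comm B = B.

Definition Ann (A : pzRingType) (r : A) : set A := [set c | r * c = 0].

(* Main.v *)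
Require Import Defs.
From mathcomp Require Import all_boot all_algebra.
From mathcomp Require Import classical_sets.
From mathcomp Require Import boolp monalg.

(** Multiplying f by a scalar a of the embedded copy of A acts coefficientwise:
    on the left it turns f_x into a f_x, on the right into f_x sigma_x(a).
    When A is commutative, f therefore commutes with every scalar exactly when
    each f_x annihilates all the differences sigma_x(a) - a
    ([Comm_embeddedP]); the scalars themselves satisfy this, since sigma_1 is the
    identity ([embedded_sub_Comm]).  The condition does not mix different
    group elements, so the commutant is larger than A if and only if some
    single term r s, with s <> 1 and r <> 0, lies in it, that is, if and only
    if some nonzero r annihilates sigma_s(a) - a for all a. *)

Import GRing.Theory.

Local Open Scope ring_scope.

Section Commutant.
Context (G : groupType).

Section ScalarProducts.
Context (A : pzRingType) (S : crossed_system G A).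
Implicit Types (f : crossed_product S) (a : A) (x : G).

Lemma coeff_scalar_mul a f x : (monom S a 1%g * f)@_x = a * f@_x.
Proof.
elim/cp_ind: f => [|f g IHf IHg|b y].
- by rewrite mulr0 mcoeff0 mulr0.
- by rewrite mulrDr !mcoeffD IHf IHg mulrDr.
by rewrite monomM sigma1 alpha_1l mulr1 mul1g !coeff_monom mulrnAr.
Qed.

Lemma coeff_mul_scalar a f x : (f * monom S a 1%g)@_x = f@_x * sigma S x a.
Proof.
elim/cp_ind: f => [|f g IHf IHg|b y].
- by rewrite mul0r mcoeff0 mul0r.
- by rewrite mulrDl !mcoeffD IHf IHg mulrDl.
rewrite monomM alpha_1r mulr1 mulg1 !coeff_monom.
by case: eqP => [->|_]; rewrite ?mulr1n ?mulr0n ?mul0r.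
Qed.

Lemma embeddedP f : embedded S f <-> forall x, x <> 1%g -> f@_x = 0.
Proof.
split=> [[a ->] x /eqP x1|f0].
  by rewrite coeff_monom eq_sym (negPf x1).
exists f@_1%g; apply/malgP => x; rewrite coeff_monom.
by case: eqP => [<-|/nesym/f0 ->]; rewrite ?mulr1n ?mulr0n.
Qed.

End ScalarProducts.

Context (A : comPzRingType) (S : crossed_system G A).

(** Comparing a f_x with f_x sigma_x(a) at each x; commutativity of A is what
    gathers the two into one product. *)
Lemma Comm_embeddedP (f : crossed_product S) :
  Comm (embedded S) f <-> forall x a, Ann f@_x (sigma S x a - a).
Proof.
split=> [comm_f x a | ann_f _ [a ->]].
  have /(congr1 (mcoeff x)) := comm_f _ (ex_intro _ a erefl).
  rewrite coeff_scalar_mul coeff_mul_scalar => e.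
  by rewrite /Ann /= mulrBr -e mulrC subrr.
apply/malgP => x; rewrite coeff_scalar_mul coeff_mul_scalar mulrC.
by apply/esym/eqP; rewrite -subr_eq0 -mulrBr; apply/eqP/ann_f.
Qed.

Lemma embedded_sub_Comm : (embedded S `<=` Comm (embedded S))%classic.
Proof.
move=> f /embeddedP f0; apply/Comm_embeddedP => x a; rewrite /Ann /=.
have [->|/eqP/f0 ->] := eqVneq x 1%g; last by rewrite mul0r.
by rewrite sigma1 subrr mulr0.
Qed.

End Commutant.

Theorem corollary4p3 (G : groupType) (A : comPzRingType)
    (S : crossed_system G A) (G_nontrivial : exists g : G, g <> 1%g) :
  maximal_commutative (embedded S)
  <-> (forall (s : G) (r : A), s <> 1%g -> r <> 0 ->
         exists a : A, ~ Ann r (sigma S s a - a)).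
Proof.
split=> [maxA s r s1 r0|sepA].
  apply: contrapT => /forallNP annr; apply: r0.
  (* A nonzero r annihilating every sigma_s(a) - a puts the term r s in the
     commutant, although it is supported away from the identity. *)
  have : Comm (embedded S) (monom S r s).
    apply/Comm_embeddedP => x a; rewrite /Ann /= coeff_monom.
    by case: eqP => [<-|_]; [exact: contrapT (annr a) | rewrite mul0r].
  by rewrite maxA => /embeddedP/(_ s s1); rewrite coeff_monom eqxx.
apply/seteqP; split; last exact: embedded_sub_Comm.
move=> f /Comm_embeddedP ann_f; apply/embeddedP => s s1.
apply: contrapT => fs0; have [a] := sepA s _ s1 fs0.
by apply; apply: ann_f.
Qed.
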